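(* Let $\mathcal{H}$ be a complex Hilbert space and let $T=\begin{bmatrix} T_{11} & T_{12}\\ T_{21} & T_{22}\end{bmatrix}\in\mathcal{B}(\mathcal{H}\oplus\mathcal{H})$ be accretive-dissipative, with Cartesian decomposition $$T=\begin{bmatrix} A_{11} & A_{12}\\ A_{12}^* & A_{22}\end{bmatrix}+\mathrm{i}\begin{bmatrix} B_{11} & B_{12}\\ B_{12}^* & B_{22}\end{bmatrix},$$ where all blocks belong to $\mathcal{B}(\mathcal{H})$. Then $$\omega(T_{12})\le\frac12\left\|A_{11}+A_{22}+B_{11}+B_{22}\right\|$$ and $$\omega(T_{12})\le\sqrt{\left\|A_{11}+B_{11}\right\|\,\left\|A_{22}+B_{22}\right\|}.$$ Further, both inequalities are sharp, i.e., for each of them there exist a complex Hilbert space $\mathcal{H}$ and an accretive-dissipative $T\in\mathcal{B}(\mathcal{H}\oplus\mathcal{H})$ for which equality holds with both sides nonzero.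
   Context: $\mathcal{B}(\mathcal{K})$ denotes the algebra of bounded linear operators on a complex Hilbert space $\mathcal{K}$, and $\|\cdot\|$ is the operator norm. The numerical radius of $S\in\mathcal{B}(\mathcal{K})$ is $\omega(S)=\sup_{\|x\|=1}|\langle Sx,x\rangle|$. The real and imaginary parts of $S$ are $\mathcal{R}S=\frac{S+S^*}{2}$ and $\mathcal{I}S=\frac{S-S^*}{2\mathrm{i}}$, both self-adjoint, and the Cartesian decomposition of $S$ is $S=\mathcal{R}S+\mathrm{i}\,\mathcal{I}S$; thus in the claim $\begin{bmatrix} A_{11} & A_{12}\\ A_{12}^* & A_{22}\end{bmatrix}=\mathcal{R}T$ and $\begin{bmatrix} B_{11} & B_{12}\\ B_{12}^* & B_{22}\end{bmatrix}=\mathcal{I}T$. An operator $S$ is positive ($S\ge O$) if $\langle Sx,x\rangle\ge0$ for all $x$; $S$ is accretive-dissipative if $\mathcal{R}S\ge O$ and $\mathcal{I}S\ge O$. *)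

(* Defs.v *)
From HB Require Import structures.
From mathcomp Require Import all_boot all_order all_algebra.
From mathcomp Require Import sesquilinear complex.
From mathcomp Require Import boolp classical_sets functions reals topology normedtype.
From mathcomp Require Import ring lra.

Set Implicit Arguments.
Unset Strict Implicit.
Unset Printing Implicit Defensive.

Import Order.TTheory GRing.Theory Num.Theory.
Import numFieldNormedType.Exports.

Local Open Scope classical_set_scope.
Local Open Scope ring_scope.

(* The inner product is linear in its first argument and conjugate-linear in the
   second; [inner_norm] makes the norm of the complete normed module the one
   induced by it. *)
HB.mixin Record NormedModule_isPreHilbert (R : realType) H
    & NormedModule R[i] H := {
  inner : {dot H for (@Num.conj R[i])};
  inner_norm : forall x : H, inner x x = `|x| ^+ 2
}.

#[short(type="hilbertType")]
HB.structure Definition Hilbert (R : realType) :=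
  {H of CompleteNormedModule R[i] H & NormedModule_isPreHilbert R H}.

(* Hilbert direct sum: an alias of the product type, because [(H * K)%type]
   already carries the sup norm. *)
Definition dsum (H K : Type) : Type := (H * K)%type.

Section dsum_norm.
Variables (R : realType) (H K : normedModType R[i]).

HB.instance Definition _ := GRing.Lmodule.copy (dsum H K) (H * K)%type.

Definition dsum_norm (x : dsum H K) : R[i] := sqrtC (`|x.1| ^+ 2 + `|x.2| ^+ 2).

Lemma dsum_norm_ge0 x : 0 <= dsum_norm x.
Proof. by rewrite sqrtC_ge0 addr_ge0// exprn_ge0. Qed.

Lemma sqr_dsum_norm x : dsum_norm x ^+ 2 = `|x.1| ^+ 2 + `|x.2| ^+ 2.
Proof. exact: sqrtCK. Qed.

Lemma dsum_normD x y : dsum_norm (x + y) <= dsum_norm x + dsum_norm y.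
Proof.
have nn (z : R[i]) : 0 <= z -> z \is Num.nneg by [].
have le1 : dsum_norm (x + y) ^+ 2 <=
    (`|x.1| + `|y.1|) ^+ 2 + (`|x.2| + `|y.2|) ^+ 2.
  by rewrite sqr_dsum_norm lerD// ler_sqr ?nn ?addr_ge0// ler_normD.
rewrite -ler_sqr ?nn ?addr_ge0 ?dsum_norm_ge0//; apply: le_trans le1 _.
rewrite [leRHS]sqrrD !sqr_dsum_norm !sqrrD.
set a := `|x.1|; set b := `|x.2|; set c := `|y.1|; set d := `|y.2|.
set p := dsum_norm x; set q := dsum_norm y.
have : a * c + b * d <= p * q.
  rewrite -ler_sqr ?nn ?addr_ge0 ?mulr_ge0 ?dsum_norm_ge0 ?normr_ge0//.
  rewrite exprMn !sqr_dsum_norm -/a -/b -/c -/d -subr_ge0.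
  have -> : (a ^+ 2 + b ^+ 2) * (c ^+ 2 + d ^+ 2) - (a * c + b * d) ^+ 2 =
            (a * d - b * c) ^+ 2 by ring.
  by rewrite real_exprn_even_ge0// realB// realM// normr_real.
move=> le2; rewrite -subr_ge0.
have -> : a ^+ 2 + b ^+ 2 + p * q *+ 2 + (c ^+ 2 + d ^+ 2)
   - (a ^+ 2 + a * c *+ 2 + c ^+ 2 + (b ^+ 2 + b * d *+ 2 + d ^+ 2)) =
   (p * q - (a * c + b * d)) *+ 2 by ring.
by rewrite mulrn_wge0// subr_ge0.
Qed.

Lemma dsum_normZ (l : R[i]) x : dsum_norm (l *: x) = `|l| * dsum_norm x.
Proof.
rewrite /dsum_norm /= !normrZ !exprMn -mulrDr rootCMl ?exprn_ge0//.
by rewrite exprCK.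
Qed.

Lemma dsum_norm0_eq0 x : dsum_norm x = 0 -> x = 0.
Proof.
move/eqP; rewrite sqrtC_eq0 paddr_eq0 ?exprn_ge0// !sqrf_eq0 !normr_eq0.
by case: x => a b /= /andP[/eqP-> /eqP->].
Qed.

HB.instance Definition _ := Lmodule_isNormed.Build R[i] (dsum H K)
  dsum_normD dsum_normZ dsum_norm0_eq0.

Lemma dsum_normE (x : dsum H K) : `|x| = sqrtC (`|x.1| ^+ 2 + `|x.2| ^+ 2).
Proof. by []. Qed.

End dsum_norm.

Section dsum_complete.
Variables (R : realType) (H K : completeNormedModType R[i]).

Lemma dsum_norm_fst (x : dsum H K) : `|x.1| <= `|x|.
Proof.
have nn (z : R[i]) : 0 <= z -> z \is Num.nneg by [].
by rewrite -ler_sqr ?nn// sqr_dsum_norm lerDl exprn_ge0.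
Qed.

Lemma dsum_norm_snd (x : dsum H K) : `|x.2| <= `|x|.
Proof.
have nn (z : R[i]) : 0 <= z -> z \is Num.nneg by [].
by rewrite -ler_sqr ?nn// sqr_dsum_norm lerDr exprn_ge0.
Qed.

Lemma dsum_norm_le (x : dsum H K) : `|x| <= `|x.1| + `|x.2|.
Proof.
have nn (z : R[i]) : 0 <= z -> z \is Num.nneg by [].
rewrite -ler_sqr ?nn ?addr_ge0// sqr_dsum_norm sqrrD addrAC lerDl.
by rewrite mulrn_wge0// mulr_ge0.
Qed.

Lemma dsum_complete (F : set_system (dsum H K)) :
  ProperFilter F -> cauchy F -> cvg F.
Proof.
move=> FF /(cauchyP F) Fc.
have c1 : cvg ((fst : dsum H K -> H) @ F).
  apply: cauchy_cvg; apply: cauchy_exP => e e0.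
  have [x Fx] := Fc e e0; exists x.1.
  suff : F [set y | ball x.1 e y.1] by [].
  apply: filterS Fx => y.
  rewrite -!ball_normE /= => xy; apply: le_lt_trans xy.
  exact: (dsum_norm_fst (x - y)).
have c2 : cvg ((snd : dsum H K -> K) @ F).
  apply: cauchy_cvg; apply: cauchy_exP => e e0.
  have [x Fx] := Fc e e0; exists x.2.
  suff : F [set y | ball x.2 e y.2] by [].
  apply: filterS Fx => y.
  rewrite -!ball_normE /= => xy; apply: le_lt_trans xy.
  exact: (dsum_norm_snd (x - y)).
move/cvg_ex : c1 => [a Fa]; move/cvg_ex : c2 => [b Fb].
apply/cvg_ex; exists ((a, b) : dsum H K).
apply/cvgrPdist_lt => e e0; near=> y.
apply: le_lt_trans (dsum_norm_le _) _; rewrite (splitr e) ltrD//.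
  by near: y; move/cvgrPdist_lt : Fa; apply; rewrite divr_gt0.
by near: y; move/cvgrPdist_lt : Fb; apply; rewrite divr_gt0.
Unshelve. all: by end_near. Qed.

HB.instance Definition _ := Uniform_isComplete.Build (dsum H K) dsum_complete.

End dsum_complete.

Section dsum_inner.
Variables (R : realType) (H K : hilbertType R).

Definition dsum_inner (x y : dsum H K) : R[i] := inner x.1 y.1 + inner x.2 y.2.

Lemma dsum_inner_bilinear :
  bilinear_for *%R (@Num.conj R[i] \; *%R) dsum_inner.
Proof.
split=> [z a x y | z a x y]; rewrite /dsum_inner /=.
- by rewrite !linearPl mulrDr addrACA.
- by rewrite !linearPr /= mulrDr addrACA.
Qed.

HB.instance Definition _ := bilinear_isBilinear.Build R[i] (dsum H K) (dsum H K)
  R[i] *%R (@Num.conj R[i] \; *%R) dsum_inner dsum_inner_bilinear.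

Lemma dsum_inner_hermitian (x y : dsum H K) :
  dsum_inner x y = (-1) ^+ false * (dsum_inner y x)^*.
Proof.
by rewrite /dsum_inner rmorphD mulrDr /= -!(hermC (inner : {dot _ for _})).
Qed.

HB.instance Definition _ := isHermitianSesquilinear.Build R[i] (dsum H K)
  false (@Num.conj R[i]) dsum_inner dsum_inner_hermitian.

Lemma dsum_inner_norm (x : dsum H K) : dsum_inner x x = `|x| ^+ 2.
Proof. by rewrite /dsum_inner !inner_norm [RHS]sqr_dsum_norm. Qed.

Lemma dsum_inner_gt0 (x : dsum H K) : x != 0 -> 0 < dsum_inner x x.
Proof. by move=> x0; rewrite dsum_inner_norm exprn_gt0// normr_gt0. Qed.

HB.instance Definition _ := isDotProduct.Build R[i] (dsum H K)
  dsum_inner dsum_inner_gt0.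

HB.instance Definition _ := NormedModule_isPreHilbert.Build R (dsum H K)
  dsum_inner_norm.

End dsum_inner.

HB.mixin Record isBoundedOp (K : numFieldType) (V W : normedModType K)
    (f : V -> W) := {
  op_bounded : exists M : K, forall x, `|f x| <= M * `|x|
}.

#[short(type="boundedOp")]
HB.structure Definition BoundedOp (K : numFieldType) (V W : normedModType K) :=
  {f of @GRing.Linear K V W *:%R f & @isBoundedOp K V W f}.

Section operators.
Variable R : realType.

(* Both suprema are over nonempty bounded sets of reals when [S] is a bounded
   operator, except for [numerical_radius] on the zero space, where
   [sup set0 = 0]. [complex.Re] only converts the norm, a nonnegative element of
   [R[i]], to a real number. *)
Definition opnorm (H K : normedModType R[i]) (S : H -> K) : R :=
  sup [set complex.Re `|S x| | x in [set x : H | `|x| <= 1]].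

Definition numerical_radius (H : hilbertType R) (S : H -> H) : R :=
  sup [set complex.Re `|inner (S x) x| | x in [set x : H | `|x| = 1]].

(* For a bounded operator [S], the vector [z] exists by the Riesz representation
   theorem, and it is always unique. *)
Definition adjoint (H K : hilbertType R) (S : H -> K) : K -> H :=
  fun y => get [set z : H | forall x : H, inner (S x) y = inner x z].

Definition re_op (H : hilbertType R) (S : H -> H) : H -> H :=
  fun x => 2^-1 *: (S x + adjoint S x).

Definition im_op (H : hilbertType R) (S : H -> H) : H -> H :=
  fun x => (2 * 'i%C)^-1 *: (S x - adjoint S x).

Definition positive_op (H : hilbertType R) (S : H -> H) : Prop :=
  forall x : H, 0 <= inner (S x) x.

Definition accretive_dissipative (H : hilbertType R) (S : H -> H) : Prop :=
  positive_op (re_op S) /\ positive_op (im_op S).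

Definition block_op (H : hilbertType R) (S11 S12 S21 S22 : H -> H) :
    dsum H H -> dsum H H :=
  fun x => (S11 x.1 + S12 x.2, S21 x.1 + S22 x.2).

Definition cartesian_blocks (H : hilbertType R) (T : dsum H H -> dsum H H)
    (T11 T12 T21 T22 A11 A12 A22 B11 B12 B22 : boundedOp H H) : Prop :=
  [/\ T =1 block_op T11 T12 T21 T22,
      re_op T =1 block_op A11 A12 (adjoint A12) A22 &
      im_op T =1 block_op B11 B12 (adjoint B12) B22].

End operators.

(* Main.v *)
Require Import Defs.
From HB Require Import structures.
From mathcomp Require Import all_boot all_order all_algebra.
From mathcomp Require Import sesquilinear complex.
From mathcomp Require Import boolp classical_sets functions reals topology normedtype.
From mathcomp Require Import ring lra.

Set Implicit Arguments.
Unset Strict Implicit.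
Unset Printing Implicit Defensive.

Import Order.TTheory GRing.Theory Num.Theory.
Import numFieldNormedType.Exports.

Local Open Scope classical_set_scope.
Local Open Scope ring_scope.

(** Write the real part of [T] as a block operator [A] and its imaginary part as
    a block operator [B], both positive. Conjugating [B] by the unitary
    [U = diag(1, i)] multiplies its upper off-diagonal block by [i] and keeps its
    diagonal blocks, so [A + U^* B U] is a positive block operator whose diagonal
    blocks are [A11 + B11] and [A22 + B22], and whose upper off-diagonal block is
    [A12 + i B12 = T12]. The Cauchy-Schwarz inequality of a positive block
    operator then gives, for every [x],
      [|<T12 x, x>|^2 <= <(A11 + B11) x, x> <(A22 + B22) x, x>]
    (lemma [offdiag_le]). For [x] of norm 1, the two factors are at most the
    norms of [A11 + B11] and [A22 + B22], which is the geometric mean bound. By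
    the arithmetic-geometric mean inequality the square root of the product is at
    most half of [<(A11 + A22 + B11 + B22) x, x>], which is the other bound.

    The positivity of the quadratic form of [A] alone forces the lower
    off-diagonal entry to be conjugate to the upper one. The lower block can
    therefore be any function vanishing at 0, and [adjoint A12] is one of them
    because the Riesz vector of 0 is 0.

    Equality holds in both bounds for the block operator all of whose blocks are
    the identity, on any nonzero space: it is self-adjoint and positive, [T12] is
    the identity and has numerical radius 1, the sum of the diagonal blocks has
    norm 2 and each of them has norm 1. The complex line is taken as the space,
    once it is known to be a Hilbert space. *)

(** * Nonnegative Hermitian forms in two variables *)

(** The form is that of the matrix [[a, c; d, b]] at the vectors [(1, z)]. Its
    values at [z = 1] and [z = 'i] are real, hence [d = c^*]; it then suffices to
    look at [z = - t c^*] with [t] real, the direction in which the cross terms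
    are most negative: [t = 1 / b] minimizes the form if [b] is nonzero, and if
    [b = 0] the form is affine in [t], so [c = 0]. *)
Lemma nonneg_hermitian_form_le (C : numClosedFieldType) (a b c d : C) :
  0 <= b ->
  (forall z, 0 <= a + z * c + z^* * d + `|z| ^+ 2 * b) ->
  `|c| ^+ 2 <= a * b.
Proof.
move=> b0 h.
have a0 : 0 <= a.
  by have := h 0; rewrite conjC0 normr0 expr0n /= !mul0r !addr0.
have dE : d = c^*.
  have s_real : c + d \is Num.real.
    have := ger0_real (h 1).
    rewrite conjC1 normr1 expr1n !mul1r => r.
    have -> : c + d = a + c + d + b - (a + b) by ring.
    by rewrite rpredB// rpredD// ger0_real.
  have t_real : 'i * (c - d) \is Num.real.
    have := ger0_real (h 'i).
    rewrite conjCi normCi expr1n !mul1r => r.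
    have -> : 'i * (c - d) = a + 'i * c + - 'i * d + b - (a + b) by ring.
    by rewrite rpredB// rpredD// ger0_real.
  move/CrealP: s_real; rewrite rmorphD /= => e1.
  move/CrealP: t_real; rewrite rmorphM rmorphB /= conjCi mulNr => e2.
  have e3 : c^* - d^* = d - c.
    by apply: (mulfI (neq0Ci C)); rewrite -[LHS]opprK e2 -mulrN opprB.
  have : 2 * c^* = 2 * d.
    have -> : 2 * c^* = (c^* + d^*) + (c^* - d^*) by ring.
    by rewrite e1 e3; ring.
  have n2 : 2 != 0 :> C by rewrite pnatr_eq0.
  by move/(mulfI n2).
have ht t : t \is Num.real -> 0 <= a - 2 * t * `|c| ^+ 2 + t ^+ 2 * `|c| ^+ 2 * b.
  move=> tr; have := h (- (t * c^*)).
  rewrite dE normrN normrM norm_conjC exprMn real_normK// rmorphN rmorphM /=.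
  rewrite conjCK (CrealP tr) normCK.
  by congr (0 <= _); ring.
have [b_eq0|bn0] := eqVneq b 0.
  rewrite b_eq0 mulr0; case: (eqVneq c 0) => [->|cn0].
    by rewrite normr0 expr0n.
  have normc_neq0 : `|c| != 0 by rewrite normr_eq0.
  (* at this [t] the form takes the value [- 1] *)
  have := ht ((a + 1) / (2 * `|c| ^+ 2)); rewrite ger0_real; last first.
    by rewrite divr_ge0 ?addr_ge0 ?mulr_ge0 ?exprn_ge0.
  rewrite b_eq0 mulr0 addr0.
  have -> : a - 2 * ((a + 1) / (2 * `|c| ^+ 2)) * `|c| ^+ 2 = - 1 by field.
  by rewrite oppr_ge0 ler10 => /(_ isT).
have bp : 0 < b by rewrite lt_def bn0.
have := ht b^-1; rewrite realV ger0_real// => /(_ isT).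
have -> : a - 2 * b^-1 * `|c| ^+ 2 + b^-1 ^+ 2 * `|c| ^+ 2 * b =
  (a * b - `|c| ^+ 2) / b by field.
by rewrite pmulr_lge0 ?invr_gt0// subr_ge0.
Qed.

(** * Inner products, adjoints and the Cartesian decomposition *)

Section hilbert.
Variable R : realType.
Implicit Types H K : hilbertType R.

Lemma inner_ge0 H (x : H) : 0 <= inner x x.
Proof. by rewrite inner_norm exprn_ge0. Qed.

Lemma cauchy_schwarz H (x y : H) : `|inner x y| <= `|x| * `|y|.
Proof.
rewrite -ler_sqr ?nnegrE ?mulr_ge0// exprMn -!inner_norm.
apply: (nonneg_hermitian_form_le (d := inner y x) (inner_ge0 _)) => z.
have -> : inner x x + z * inner x y + z^* * inner y x + `|z| ^+ 2 * inner y y =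
  inner (z^* *: y + x) (z^* *: y + x); last exact: inner_ge0.
rewrite linearPl !linearPr /= conjCK normCK; ring.
Qed.

Lemma inner_inj H (y z : H) : (forall x, inner x y = inner x z) -> y = z.
Proof.
move=> yz; apply/eqP; rewrite -subr_eq0 -normr_eq0 -sqrf_eq0 -inner_norm.
by rewrite linearBr /= yz subrr.
Qed.

(** Uniqueness of the Riesz vector: exhibiting one is enough to compute the
    adjoint, which is otherwise chosen arbitrarily. *)
Lemma adjointE H K (S : H -> K) (y : K) (z : H) :
  (forall x, inner (S x) y = inner x z) -> adjoint S y = z.
Proof.
move=> Sz; have := @getPex _ [set w | forall x, inner (S x) y = inner x w].
by move=> /(_ (ex_intro _ z Sz)) Sw; apply: inner_inj => x; rewrite -Sw Sz.
Qed.

Lemma adjoint_self H (S : H -> H) :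
  (forall x y, inner (S x) y = inner x (S y)) -> adjoint S =1 S.
Proof. by move=> SS y; apply: adjointE. Qed.

Lemma adjoint0 H K (S : H -> K) : adjoint S 0 = 0.
Proof. by apply: adjointE => x; rewrite !linear0r. Qed.

(** The two terms in [adjoint S x] cancel, since ['i * (2 * 'i)^-1 = 2^-1]. *)
Lemma cartesian_decomposition H (S : H -> H) (x : H) :
  S x = re_op S x + 'i *: im_op S x.
Proof.
have E (h i k : R[i]) (v w : H) : i * k = h -> h + h = 1 ->
    v = h *: (v + w) + i *: (k *: (v - w)).
  move=> ik hh; rewrite scalerA ik -scalerDr addrACA subrr addr0.
  by rewrite scalerDr -scalerDl hh scale1r.
apply: E; last by rewrite -div1r -splitr.
by rewrite complexiE invfM mulrCA divff ?neq0Ci// mulr1.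
Qed.


Lemma im_op_selfadjoint H (S : H -> H) : adjoint S =1 S -> im_op S =1 \0.
Proof. by move=> SS x; rewrite /im_op SS subrr scaler0. Qed.

Lemma re_op_selfadjoint H (S : H -> H) : adjoint S =1 S -> re_op S =1 S.
Proof.
move=> SS x.
by rewrite [RHS]cartesian_decomposition im_op_selfadjoint// scaler0 addr0.
Qed.

(** * The off-diagonal block of an accretive-dissipative operator *)

Lemma block_form H (S11 S12 S21 S22 : H -> H) (u v : H) :
  inner (block_op S11 S12 S21 S22 (u, v)) (u, v) =
  inner (S11 u) u + inner (S12 v) u + inner (S21 u) v + inner (S22 v) v.
Proof.
rewrite -[LHS]/(inner (S11 u + S12 v) u + inner (S21 u + S22 v) v).
by rewrite !linearDl /= addrA.
Qed.

Lemma positive_block_diag H (S11 S12 S22 : boundedOp H H) (S21 : H -> H) :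
  S21 0 = 0 -> positive_op (block_op S11 S12 S21 S22) ->
  positive_op S11 /\ positive_op S22.
Proof.
move=> S0 S_ge0; split=> x.
- by have := S_ge0 (x, 0); rewrite block_form !linear0 ?linear0l ?linear0r !addr0.
- by have := S_ge0 (0, x); rewrite block_form S0 !linear0 ?linear0l ?linear0r !add0r.
Qed.

(** Cauchy-Schwarz for the sum of the block operator with entries [A] and of the
    one with entries [B] conjugated by [diag(1, 'i)]: the form of this sum at
    [(u, z *: v)] is the form of [A] at [(u, z *: v)] plus the form of [B] at
    [(u, ('i * z) *: v)]. *)
Lemma offdiag_le H (A11 A12 A22 B11 B12 B22 : boundedOp H H) (A21 B21 : H -> H) :
  A21 0 = 0 -> B21 0 = 0 ->
  positive_op (block_op A11 A12 A21 A22) ->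
  positive_op (block_op B11 B12 B21 B22) ->
  forall u v, `|inner (A12 v + 'i *: B12 v) u| ^+ 2 <=
    inner (A11 u + B11 u) u * inner (A22 v + B22 v) v.
Proof.
move=> A0 B0 A_ge0 B_ge0 u v.
have [_ A22_ge0] := positive_block_diag A0 A_ge0.
have [_ B22_ge0] := positive_block_diag B0 B_ge0.
apply: (nonneg_hermitian_form_le
  (d := inner (A21 u) v + 'i^* * inner (B21 u) v)).
  by rewrite linearDl addr_ge0 //; [apply: A22_ge0|apply: B22_ge0].
move=> z; have := addr_ge0 (A_ge0 (u, z *: v)) (B_ge0 (u, ('i * z) *: v)).
rewrite !block_form !linearDl !linearZ /= !linearZl_LR /= rmorphM normCK /=.
have i2 : 'i^* * 'i = 1 :> R[i] by rewrite mulrC -normCK normCi expr1n.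
by congr (0 <= _); ring: i2.
Qed.

(** * Operator norm and numerical radius *)

Lemma bounded_opnorm_ub H (S : boundedOp H H) (x : H) :
  `|x| <= 1 -> complex.Re `|S x| <= opnorm S.
Proof.
move=> x1; apply: ub_le_sup; last by exists x.
have [M SM] := op_bounded (s := S); exists (complex.Re `|M|) => _ [y y1 <-].
have My_ge0 : 0 <= M * `|y| by apply: le_trans (SM y).
have : `|S y| <= `|M|.
  apply: le_trans (SM y) _; rewrite -(ger0_norm My_ge0) normrM normr_id.
  exact: ler_piMr.
by rewrite lecE => /andP[_].
Qed.

Lemma bounded_add H (S T : boundedOp H H) :
  exists M : R[i], forall x, `|(S \+ T) x| <= M * `|x|.
Proof.
have [M SM] := op_bounded (s := S); have [N TN] := op_bounded (s := T).
exists (M + N) => x; rewrite mulrDl.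
by apply: le_trans (ler_normD _ _) _; apply: lerD.
Qed.

Lemma opnorm_ge0 H (S : boundedOp H H) : 0 <= opnorm S.
Proof.
have := @bounded_opnorm_ub _ S 0; rewrite linear0 normr0 /=.
by apply; rewrite ler01.
Qed.

HB.instance Definition _ H (S T : boundedOp H H) :=
  isBoundedOp.Build R[i] H H (S \+ T) (bounded_add S T).

Lemma inner_le_opnorm H (S : boundedOp H H) (x : H) :
  `|x| = 1 -> complex.Re (inner (S x) x) <= opnorm S.
Proof.
move=> x1; apply: le_trans (bounded_opnorm_ub S (x := x) _); last by rewrite x1.
have := cauchy_schwarz (S x) x; rewrite x1 mulr1.
move/(le_trans (normc_ge_Re _)); rewrite lecE => /andP[_ /=].
exact/le_trans/ler_norm.
Qed.

(** The bound [M] has to be nonnegative for the zero space, whose unit sphere is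
    empty. *)
Lemma numerical_radius_le H (S : H -> H) (M : R) : 0 <= M ->
  (forall x : H, `|x| = 1 -> complex.Re `|inner (S x) x| <= M) ->
  numerical_radius S <= M.
Proof.
move=> M0 SM; rewrite /numerical_radius.
set E := (X in sup X); have [->|/set0P E0] := eqVneq E set0.
  by rewrite sup0.
by apply: ge_sup E0 _ => _ [x x1 <-]; apply: SM.
Qed.

(** * The two bounds *)

Section bounds.
Variables (H : hilbertType R) (T : boundedOp (dsum H H) (dsum H H)).
Variables (T11 T12 T21 T22 A11 A12 A22 B11 B12 B22 : boundedOp H H).
Hypothesis T_ad : accretive_dissipative T.
Hypothesis T_blocks :
  cartesian_blocks T T11 T12 T21 T22 A11 A12 A22 B11 B12 B22.

Lemma cartesian_blocks_offdiag v : T12 v = A12 v + 'i *: B12 v.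
Proof.
have [TE reE imE] := T_blocks.
have := cartesian_decomposition T (0, v); rewrite TE reE imE => /(congr1 fst) /=.
by rewrite !linear0 !add0r.
Qed.

Let A_ge0 : positive_op (block_op A11 A12 (adjoint A12) A22).
Proof. by have [_ reE _] := T_blocks; case: T_ad => re0 _ x; rewrite -reE. Qed.

Let B_ge0 : positive_op (block_op B11 B12 (adjoint B12) B22).
Proof. by have [_ _ imE] := T_blocks; case: T_ad => _ im0 x; rewrite -imE. Qed.

Let AB1_ge0 : positive_op (A11 \+ B11).
Proof.
have [A0 _] := positive_block_diag (adjoint0 _) A_ge0.
have [B0 _] := positive_block_diag (adjoint0 _) B_ge0.
by move=> x; rewrite linearDl addr_ge0 ?A0 ?B0.
Qed.

Let AB2_ge0 : positive_op (A22 \+ B22).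
Proof.
have [_ A0] := positive_block_diag (adjoint0 _) A_ge0.
have [_ B0] := positive_block_diag (adjoint0 _) B_ge0.
by move=> x; rewrite linearDl addr_ge0 ?A0 ?B0.
Qed.

Let a x := complex.Re (inner ((A11 \+ B11) x) x).
Let b x := complex.Re (inner ((A22 \+ B22) x) x).

Let a_ge0 x : 0 <= a x.
Proof. by have := AB1_ge0 x; rewrite lecE => /andP[]. Qed.

Let b_ge0 x : 0 <= b x.
Proof. by have := AB2_ge0 x; rewrite lecE => /andP[]. Qed.

Let form_le x : complex.Re `|inner (T12 x) x| ^+ 2 <= a x * b x.
Proof.
have := offdiag_le (adjoint0 _) (adjoint0 _) A_ge0 B_ge0 x x.
rewrite -cartesian_blocks_offdiag -lecR /a /b rmorphXn rmorphM /=.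
by rewrite !RRe_real// ger0_real// ?AB1_ge0 ?AB2_ge0.
Qed.

Lemma numerical_radius_offdiag_le_mean :
  numerical_radius T12 <= 2^-1 * opnorm (A11 \+ A22 \+ B11 \+ B22).
Proof.
apply: numerical_radius_le => [|x x1].
  by rewrite mulr_ge0 ?invr_ge0 ?ler0n ?opnorm_ge0.
have : a x + b x <= opnorm (A11 \+ A22 \+ B11 \+ B22).
  apply: le_trans (inner_le_opnorm _ x1).
  rewrite /a /b -raddfD -linearDl /=.
  by rewrite addrACA addrA.
move: (form_le x) (a_ge0 x) (b_ge0 x).
set t := complex.Re _ => t2 a0 b0 ab; rewrite leNgt; apply/negP => lt_t.
have : 0 < (t - (a x + b x) / 2) * (t + (a x + b x) / 2).
  by apply: mulr_gt0; lra.
(* [a x * b x <= ((a x + b x) / 2) ^+ 2] contradicts [t ^+ 2 <= a x * b x] *)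
have := sqr_ge0 (a x - b x); nra.
Qed.

Lemma numerical_radius_offdiag_le_geometric :
  numerical_radius T12 <= Num.sqrt (opnorm (A11 \+ B11) * opnorm (A22 \+ B22)).
Proof.
apply: numerical_radius_le => [|x x1]; first exact: sqrtr_ge0.
apply: le_trans (ler_norm _) _; rewrite -sqrtr_sqr ler_wsqrtr//.
apply: le_trans (form_le x) _.
by rewrite ler_pM// ?a_ge0 ?b_ge0// inner_le_opnorm.
Qed.

End bounds.
End hilbert.

(** * The complex line as a Hilbert space *)

(** An alias, so that the instances declared on it do not compete with those of
    the regular module of an arbitrary ring. *)
Definition complex_line (R : realType) : Type := R[i]^o.

Section complex_line.
Variable R : realType.
Local Notation C := (complex_line R).

HB.instance Definition _ := NormedModule.copy C R[i]^o.

(** The real and imaginary parts are 1-Lipschitz, so they map a Cauchy filter to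
    Cauchy filters of the complete field [R], whose limits are the coordinates of
    the limit sought. *)
Lemma complex_line_complete (F : set_system C) :
  ProperFilter F -> cauchy F -> cvg F.
Proof.
move=> FF /(cauchyP F) Fc.
have cvg_part (p : C -> R) :
    (forall x y : C, `|p x - p y|%:C%C <= `|x - y|) -> cvg (p @ F).
  move=> p_le; apply: cauchy_cvg; apply: cauchy_exP => e e0.
  have [x Fx] : exists x, F (ball x e%:C%C) by apply: Fc; rewrite ltcR.
  exists (p x); suff : F [set y | ball (p x) e (p y)] by [].
  apply: filterS Fx => y; rewrite -!ball_normE /= => xy.
  by rewrite -ltcR; apply: le_lt_trans xy.
have /cvg_ex[a Fa] : cvg ((@complex.Re R : C -> R) @ F).
  by apply: cvg_part => x y; rewrite -raddfB; exact: normc_ge_Re.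
have /cvg_ex[b Fb] : cvg ((@complex.Im R : C -> R) @ F).
  apply: cvg_part => x y; rewrite -raddfB.
  have := normc_ge_Re ((x - y : R[i]) * 'i%C).
  by rewrite ReiNIm normrN normrM complexiE normCi mulr1.
apply/cvg_ex; exists ((a +i* b)%C : C).
apply/cvgrPdist_lt => e e0.
have eE : e = (complex.Re e)%:C%C by rewrite RRe_real// gtr0_real.
have Re_e : 0 < complex.Re e / 2 by rewrite divr_gt0// -ltcR -eE.
near=> y.
have -> : ((a +i* b)%C : C) - y =
    (a - complex.Re y)%:C%C + 'i%C * (b - complex.Im y)%:C%C.
  by rewrite [LHS]complexE !raddfB.
have norm_real (r : R) : `|r%:C%C| = `|r|%:C%C.
  by rewrite normc_def /= expr0n addr0 sqrtr_sqr.
apply: le_lt_trans (ler_normD _ _) _.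
rewrite normrM complexiE normCi mul1r !norm_real eE (splitr (complex.Re e)).
rewrite -rmorphD ltcR ltrD//.
- by near: y; move/cvgrPdist_lt : Fa; apply.
- by near: y; move/cvgrPdist_lt : Fb; apply.
Unshelve. all: by end_near. Qed.

HB.instance Definition _ := Uniform_isComplete.Build C complex_line_complete.

Definition complex_line_inner (x y : C) : R[i] := (x : R[i]) * (y : R[i])^*.

Lemma complex_line_inner_bilinear :
  bilinear_for *%R (@Num.conj R[i] \; *%R) complex_line_inner.
Proof.
split=> [z a x y | z a x y]; rewrite /complex_line_inner /=.
- by rewrite mulrDl mulrA.
- by rewrite rmorphD rmorphM mulrDr mulrCA.
Qed.

HB.instance Definition _ := bilinear_isBilinear.Build R[i] C C
  R[i] *%R (@Num.conj R[i] \; *%R) complex_line_inner complex_line_inner_bilinear.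

Lemma complex_line_inner_hermitian (x y : C) :
  complex_line_inner x y = (-1) ^+ false * (complex_line_inner y x)^*.
Proof. by rewrite /complex_line_inner rmorphM /= conjCK mul1r mulrC. Qed.

HB.instance Definition _ := isHermitianSesquilinear.Build R[i] C
  false (@Num.conj R[i]) complex_line_inner complex_line_inner_hermitian.

Lemma complex_line_inner_norm (x : C) : complex_line_inner x x = `|x| ^+ 2.
Proof. by rewrite /complex_line_inner -normCK. Qed.

Lemma complex_line_inner_gt0 (x : C) : x != 0 -> 0 < complex_line_inner x x.
Proof. by move=> x0; rewrite complex_line_inner_norm exprn_gt0// normr_gt0. Qed.

HB.instance Definition _ := isDotProduct.Build R[i] C
  complex_line_inner complex_line_inner_gt0.

HB.instance Definition _ := NormedModule_isPreHilbert.Build R C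
  complex_line_inner_norm.


End complex_line.

(** * The extremal operator *)

Section all_ones_block.
Variables (R : realType) (H : hilbertType R).

Lemma idfun_bounded : exists M : R[i], forall x : H, `|idfun x| <= M * `|x|.
Proof. by exists 1 => x; rewrite mul1r. Qed.

HB.instance Definition _ := isBoundedOp.Build R[i] H H idfun idfun_bounded.

Lemma null_fun_bounded :
  exists M : R[i], forall x : H, `|(\0 : H -> H) x| <= M * `|x|.
Proof. by exists 0 => x; rewrite normr0 mul0r. Qed.

HB.instance Definition _ := isBoundedOp.Build R[i] H H \0 null_fun_bounded.

Definition all_ones_block : dsum H H -> dsum H H :=
  block_op idfun idfun idfun idfun.

Lemma all_ones_block_linear : linear all_ones_block.
Proof.
by move=> c x y; rewrite /all_ones_block /block_op /= -addrACA -scalerDr.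
Qed.

HB.instance Definition _ := GRing.isLinear.Build R[i] (dsum H H) (dsum H H)
  *:%R all_ones_block all_ones_block_linear.

Lemma all_ones_block_bounded :
  exists M : R[i], forall x, `|all_ones_block x| <= M * `|x|.
Proof.
exists (2 * 2) => x; apply: le_trans (dsum_norm_le _) _ => /=.
have le2 : `|x.1 + x.2| <= 2 * `|x|.
  apply: le_trans (ler_normD _ _) _.
  by rewrite mulr_natl mulr2n lerD ?dsum_norm_fst ?dsum_norm_snd.
by rewrite -mulrA mulr_natl mulr2n lerD.
Qed.

HB.instance Definition _ := isBoundedOp.Build R[i] (dsum H H) (dsum H H)
  all_ones_block all_ones_block_bounded.

Lemma all_ones_block_selfadjoint : adjoint all_ones_block =1 all_ones_block.
Proof.
apply: adjoint_self => x y.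
rewrite -[LHS]/(inner (x.1 + x.2) y.1 + inner (x.1 + x.2) y.2).
rewrite -[RHS]/(inner x.1 (y.1 + y.2) + inner x.2 (y.1 + y.2)).
by rewrite !linearDl !linearDr /= addrACA.
Qed.

(** The form of the operator at [(u, v)] is [|u + v| ^+ 2]. *)
Lemma all_ones_block_accretive_dissipative :
  accretive_dissipative all_ones_block.
Proof.
split=> x; last by rewrite (im_op_selfadjoint all_ones_block_selfadjoint) linear0l.
rewrite (re_op_selfadjoint all_ones_block_selfadjoint).
rewrite -[X in 0 <= X]/(inner (x.1 + x.2) x.1 + inner (x.1 + x.2) x.2).
by rewrite -linearDr inner_ge0.
Qed.

Lemma all_ones_block_cartesian :
  cartesian_blocks all_ones_block
    idfun idfun idfun idfun idfun idfun idfun \0 \0 \0.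
Proof.
have adj_id : adjoint (idfun : H -> H) =1 idfun by apply: adjoint_self.
have adj_0 : adjoint (\0 : H -> H) =1 \0.
  by apply: adjoint_self => x y; rewrite linear0l linear0r.
split=> // x.
- by rewrite (re_op_selfadjoint all_ones_block_selfadjoint) /all_ones_block /block_op adj_id.
- by rewrite (im_op_selfadjoint all_ones_block_selfadjoint) /block_op adj_0 /= !addr0.
Qed.

(** A unit vector rules out the zero space, where both quantities vanish. *)
Variable e : H.
Hypothesis e1 : `|e| = 1.

Lemma numerical_radius_id : numerical_radius (idfun : H -> H) = 1.
Proof.
rewrite /numerical_radius (_ : [set _ | _ in _] = [set 1]) ?sup1//.
have id1 (x : H) : `|x| = 1 -> complex.Re `|inner (idfun x) x| = 1.
  by move=> x1; rewrite inner_norm x1 expr1n normr1.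
apply/seteqP; split => [_ [x x1 <-]|_ ->] /=; first exact: id1.
by exists e => //; apply: id1.
Qed.

Lemma opnorm_mulrn (S : H -> H) (n : nat) :
  (forall x, S x = x *+ n) -> opnorm S = n%:R.
Proof.
move=> Sn.
have normS x : complex.Re `|S x| = complex.Re `|x| *+ n.
  by rewrite Sn normrMn raddfMn.
have ubS : ubound [set complex.Re `|S x| | x in [set x : H | `|x| <= 1]] n%:R.
  move=> _ [x /= x1 <-]; rewrite normS; apply: ler_wMn2r.
  by move: x1; rewrite lecE => /andP[].
apply/eqP; rewrite eq_le; apply/andP; split.
- by apply: ge_sup ubS; exists (complex.Re `|S e|); exists e => //=; rewrite e1.
- apply: ub_le_sup; first by exists n%:R.
  by exists e; rewrite /= ?normS e1.
Qed.

End all_ones_block.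

Theorem theorem2p3 (R : realType) :
  (forall (H : hilbertType R) (T : boundedOp (dsum H H) (dsum H H))
      (T11 T12 T21 T22 A11 A12 A22 B11 B12 B22 : boundedOp H H),
    accretive_dissipative T ->
    cartesian_blocks T T11 T12 T21 T22 A11 A12 A22 B11 B12 B22 ->
    numerical_radius T12 <= 2^-1 * opnorm (A11 \+ A22 \+ B11 \+ B22) /\
    numerical_radius T12 <=
      Num.sqrt (opnorm (A11 \+ B11) * opnorm (A22 \+ B22))) /\
  (exists (H : hilbertType R) (T : boundedOp (dsum H H) (dsum H H))
      (T11 T12 T21 T22 A11 A12 A22 B11 B12 B22 : boundedOp H H),
    [/\ accretive_dissipative T,
        cartesian_blocks T T11 T12 T21 T22 A11 A12 A22 B11 B12 B22,
        numerical_radius T12 != 0 &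
        numerical_radius T12 = 2^-1 * opnorm (A11 \+ A22 \+ B11 \+ B22)]) /\
  (exists (H : hilbertType R) (T : boundedOp (dsum H H) (dsum H H))
      (T11 T12 T21 T22 A11 A12 A22 B11 B12 B22 : boundedOp H H),
    [/\ accretive_dissipative T,
        cartesian_blocks T T11 T12 T21 T22 A11 A12 A22 B11 B12 B22,
        numerical_radius T12 != 0 &
        numerical_radius T12 =
          Num.sqrt (opnorm (A11 \+ B11) * opnorm (A22 \+ B22))]).
Proof.
split.
  move=> H T T11 T12 T21 T22 A11 A12 A22 B11 B12 B22 T_ad T_blocks; split.
  - exact: numerical_radius_offdiag_le_mean T_ad T_blocks.
  - exact: numerical_radius_offdiag_le_geometric T_ad T_blocks.
pose H : hilbertType R := complex_line R.
pose I : boundedOp H H := idfun; pose O : boundedOp H H := \0.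
pose J : boundedOp (dsum H H) (dsum H H) := all_ones_block (H := H).
have e1 : `|(1 : R[i]) : H| = 1 by exact: (@normr1 R[i]).
have adJ := all_ones_block_accretive_dissipative H.
have blocksJ := all_ones_block_cartesian H.
have radius1 := numerical_radius_id e1.
split; exists H, J, I, I, I, I, I, I, I, O, O, O; split=> //; rewrite radius1.
- exact: oner_neq0.
- rewrite (opnorm_mulrn e1 (n := 2)) ?mulVf ?pnatr_eq0// => x /=.
  by rewrite !addr0.
- exact: oner_neq0.
- by rewrite !(opnorm_mulrn e1 (n := 1)) ?mulr1 ?sqrtr1// => x /=; rewrite addr0.
Qed.
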